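(* For every positive integer $n$, in every $3$-coloring of the edges of the complete graph $K_n$ there is a monochromatic connected component containing at least a sixth of the edges of $K_n$; that is, $M(n,3)\geq \left\lceil\frac{1}{6}\binom{n}{2}\right\rceil$. Moreover, this bound is sharp for $n$ sufficiently large: there exists $n_0$ such that $M(n,3)=\left\lceil\frac{1}{6}\binom{n}{2}\right\rceil$ for all $n\geq n_0$.
   Context: A $k$-coloring of the edges of $K_n$ is an arbitrary map from $E(K_n)$ to a set of $k$ colors (it need not be proper). A monochromatic connected component is a connected component of the spanning subgraph of $K_n$ formed by all edges of a single color. $M(n,k)$ denotes the largest integer $M$ such that every $k$-coloring of the edges of $K_n$ has a monochromatic connected component with at least $M$ edges. *)

(* Defs.v *)
From mathcomp Require Import all_boot all_order all_algebra.

Set Implicit Arguments.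
Unset Strict Implicit.
Unset Printing Implicit Defensive.

(* E(K_n), for K_n on the vertex set {0, ..., n-1} *)
Definition edge (n : nat) := {e : {set 'I_n} | #|e| == 2}.

(* Colorings need not be proper. *)
Definition coloring (n k : nat) := {ffun edge n -> 'I_k}.

(* Adjacency in the spanning subgraph of the edges of color i; irreflexive,
   since [set x; x] is not an edge. *)
Definition color_adj n k (c : coloring n k) (i : 'I_k) : rel 'I_n :=
  fun x y => [exists e : edge n, (val e == [set x; y]) && (c e == i)].

(* Vertices of the color-i component of x; it is {x} when x has no incident
   edge of color i. *)
Definition mono_comp n k (c : coloring n k) (i : 'I_k) (x : 'I_n) : {set 'I_n} :=
  [set y | connect (color_adj c i) x y].

(* Only the edges of color i belong to the component, not all edges of K_n
   that it spans. *)
Definition mono_comp_edges n k (c : coloring n k) (i : 'I_k) (x : 'I_n) :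
    {set edge n} :=
  [set e : edge n | (c e == i) && (val e \subset mono_comp c i x)].

Definition guaranteed (n k m : nat) : bool :=
  [forall c : coloring n k, exists i : 'I_k, exists x : 'I_n,
     m <= #|mono_comp_edges c i x|].

(* M(n, k). No m > 'C(n, 2) is guaranteed when k > 0, so restricting m to
   0, ..., 'C(n, 2) is harmless; see maxMonoP. *)
Definition maxMono (n k : nat) : nat :=
  \max_(m < 'C(n, 2).+1 | guaranteed n k m) m.

Lemma card_edge n : #|{: edge n}| = 'C(n, 2).
Proof.
rewrite card_sig -[in RHS](card_ord n) -cardsT -cards_draws -[RHS]cardsE.
by apply: eq_card => e; rewrite !inE subsetT.
Qed.

Lemma maxMonoP n k : 0 < n -> 0 < k ->
  guaranteed n k (maxMono n k) /\
  (forall m, guaranteed n k m -> m <= maxMono n k).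
Proof.
move=> n_gt0 k_gt0; split.
  have g0 : guaranteed n k (ord0 : 'I_('C(n, 2).+1)).
    apply/forallP=> c; apply/existsP; exists (Ordinal k_gt0).
    by apply/existsP; exists (Ordinal n_gt0).
  rewrite /maxMono (bigop.bigmax_eq_arg ord0) //.
  by case: arg_maxnP.
move=> m gm.
have /existsP[i /existsP[x le_m]] := forallP gm [ffun=> Ordinal k_gt0].
have lt_m : m < 'C(n, 2).+1.
  by rewrite ltnS -card_edge (leq_trans le_m) ?max_card.
exact: (@leq_bigmax_cond _ _ (fun j : 'I_('C(n, 2).+1) => val j) (Ordinal lt_m)).
Qed.

(* Main.v *)
Require Import Defs.
From mathcomp Require Import all_boot all_order all_algebra.
From mathcomp Require Import zify.

(* Lower bound. Let M be the largest number of edges of a monochromatic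
   component. A union of whole components of one colour inside a vertex set X
   contains at most sqrt(M * 'C(|X|, 2)) edges of that colour. If no colour is
   spanning, then either each colour has two components that cover all vertices,
   so that at most six components carry all the edges, or there are components
   of the three colours with pairwise disjoint complements X1, X2, X3; an edge
   of colour i outside the i-th component lies in X_i, and there are at most
   'C(n, 2) / 2 such edges when 6 M < 'C(n, 2). If a colour is spanning, one of
   the other two has at least 5/12 of the edges, and (5/12)^2 > 1/6.
   Upper bound. Split the vertices into four nearly equal parts, colour the
   edges between parts by the three perfect matchings of K_4, and spread the
   edges inside the parts so as to balance the six components. *)

Set Implicit Arguments.
Unset Strict Implicit.
Unset Printing Implicit Defensive.

(** * Three partitions such that any two vertices share a class in one of them *)

Lemma constant_or (T : finType) (U : eqType) (f : T -> U) (x : T) :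
  (forall v, f v = f x) \/ exists p, f p <> f x.
Proof.
have [/forallP h|/forallPn[p /eqP hp]] := boolP [forall v, f v == f x].
  by left=> v; apply/eqP.
by right; exists p.
Qed.

(** Take [p] outside the class of [y] and [q] outside the class of [z]. They can share only an
    [r]-class, and comparing any vertex missed by one of the two covering classes with [p] or [q]
    puts it in that same [r]-class. In the third alternative the pairwise covers say that the
    complements of the three classes are pairwise disjoint. *)
Lemma cover_two (T : finType) (U : eqType) (r b g : T -> U) (y z : T) :
    (forall u v, [\/ r u = r v, b u = b v | g u = g v]) ->
    (forall v, b v = b y \/ g v = g z) ->
  [\/ forall v, b v = b y, forall v, g v = g z |
      exists x, forall v, [/\ r v = r x \/ b v = b y, r v = r x \/ g v = g z &
                              b v = b y \/ g v = g z]].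
Proof.
move=> tot cov.
have [By|[p nBp]] := constant_or b y; first exact: Or31.
have [Gz|[q nGq]] := constant_or g z; first exact: Or32.
apply: Or33; exists p => v.
have cp := cov p; have cq := cov q; have cv := cov v.
have tpq := tot p q; have tpv := tot p v; have tqv := tot q v.
split=> //.
  have [->|/eqP nv] := eqVneq (b v) (b y); first by right.
  by left; case: tpq; case: tqv; case: cp; case: cq; case: cv; congruence.
have [->|/eqP nv] := eqVneq (g v) (g z); first by right.
by left; case: tpv; case: cp; case: cv; congruence.
Qed.

(* A colour class is encoded by the map sending a vertex to its component. *)
Lemma three_partitions (T : finType) (U : eqType) (r b g : T -> U) (a : T) :
    (forall u v, [\/ r u = r v, b u = b v | g u = g v]) ->
  [\/ [\/ exists x, forall v, r v = r x, exists x, forall v, b v = b x |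
          exists x, forall v, g v = g x],
      exists x y z, forall v,
        [/\ r v = r x \/ b v = b y, r v = r x \/ g v = g z &
            b v = b y \/ g v = g z] |
      [/\ exists x y, forall v, r v = r x \/ r v = r y,
          exists x y, forall v, b v = b x \/ b v = b y &
          exists x y, forall v, g v = g x \/ g v = g y]].
Proof.
move=> tot.
set concl := or3 _ _ _.
have cov y z : (forall v, b v = b y \/ g v = g z) -> concl.
  case/(cover_two tot) => [h|h|[x h]].
  - by apply/Or31/Or32; exists y.
  - by apply/Or31/Or33; exists z.
  - by apply: Or32; exists x, y, z.
have [ra|[w nRw]] := constant_or r a; first by apply/Or31/Or31; exists a.
have [/forallP h|/forallPn[a']] :=
    boolP [forall v, (b v == b a) || (g v == g a)].
  by apply: (cov a a) => v; case/orP: (h v) => /eqP; [left | right].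
rewrite negb_or => /andP[/eqP nBa' /eqP nGa'].
have Ra' : r a' = r a by case: (tot a' a).
(* Outside the [r]-class of [a], a vertex shares a [b]- or [g]-class with [a] and with [a']. One
   colour cannot serve for both, which leaves two types. *)
have ty v : r v <> r a -> (b v = b a /\ g v = g a') \/ (g v = g a /\ b v = b a').
  by move=> nRv; case: (tot v a) => ?; case: (tot v a') => ?; intuition congruence.
(* If one of the two types does not occur, the common [b]- and [g]-classes of the other type cover
   everything: a vertex in the [r]-class of [a] must share one of them with [w]. Otherwise [p] and
   [q] represent the two types. *)
have [/forallP h|/forallPn[p]] := boolP [forall v, (r v == r a) || (b v != b a)].
  have {ty}h v : r v <> r a -> g v = g a /\ b v = b a'.
    by move=> nv; case/orP: (h v) (ty v nv) => /eqP; intuition congruence.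
  apply: (cov a' a) => v; have [hw1 hw2] := h w nRw.
  have [Rv|/eqP/h[]] := eqVneq (r v) (r a); last by left.
  by case: (tot v w); intuition congruence.
rewrite negb_or negbK => /andP[/eqP nRp /eqP Bp].
have Gp : g p = g a' by case: (ty p nRp); intuition congruence.
have [/forallP h|/forallPn[q]] := boolP [forall v, (r v == r a) || (g v != g a)].
  have {ty}h v : r v <> r a -> b v = b a /\ g v = g a'.
    by move=> nv; case/orP: (h v) (ty v nv) => /eqP; intuition congruence.
  apply: (cov a a') => v; have [hw1 hw2] := h w nRw.
  have [Rv|/eqP/h[]] := eqVneq (r v) (r a); last by left.
  by case: (tot v w); intuition congruence.
rewrite negb_or negbK => /andP[/eqP nRq /eqP Gq].
have Bq : b q = b a' by case: (ty q nRq); intuition congruence.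
have Rpq : r p = r q by case: (tot p q) => //; congruence.
apply: Or33; split.
- exists a, p => v; have [|/eqP nRv] := eqVneq (r v) (r a); first by left.
  right; have tp := tot v p; have tq := tot v q.
  case: (ty v nRv) => -[h1 h2]; [case: tq => // | case: tp => //]; congruence.
- exists a, a' => v; have [|/eqP nRv] := eqVneq (r v) (r a); last first.
    by case: (ty v nRv) => -[]; [left | right].
  move=> Rv; case: (tot v p) => ?; case: (tot v q) => ?; intuition congruence.
- exists a, a' => v; have [|/eqP nRv] := eqVneq (r v) (r a); last first.
    by case: (ty v nRv) => -[]; [right | left].
  move=> Rv; case: (tot v p) => ?; case: (tot v q) => ?; intuition congruence.
Qed.

(** * Counting the edges of one colour *)

Lemma double_bin2 n : 2 * 'C(n, 2) = n * n.-1.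
Proof. by rewrite -(mul_bin_diag n 1) bin1. Qed.

Lemma bin2D m k : 'C(m + k, 2) = 'C(m, 2) + 'C(k, 2) + m * k.
Proof.
elim: k => [|k IHk]; first by rewrite addn0 muln0 !addn0.
by rewrite addnS !binS !bin1 IHk mulnS; lia.
Qed.

(** For [X := mono_comp c i x] this unfolds to [mono_comp_edges c i x]; the general [X] also covers
    complements of components. *)
Definition color_edges n k (c : coloring n k) (i : 'I_k) (X : {set 'I_n}) :=
  [set e : edge n | (c e == i) && (val e \subset X)].

Lemma edge_ends n (e : edge n) : exists x y, x != y /\ val e = [set x; y].
Proof. exact/cards2P/(valP e). Qed.

Lemma card_edges_within n (X : {set 'I_n}) :
  #|[set e : edge n | val e \subset X]| = 'C(#|X|, 2).
Proof.
rewrite -(cards_draws X 2) -(card_imset _ val_inj); apply: eq_card => B.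
rewrite inE; apply/imsetP/andP => [[e]|[BX B2]].
  by rewrite inE => eX ->; split=> //; apply: (valP e).
by exists (Sub B B2); rewrite ?inE SubK.
Qed.

Section Components.
Variables (n k : nat) (c : coloring n k).
Implicit Types (i : 'I_k) (x y : 'I_n) (X K : {set 'I_n}).

Lemma color_adj_sym i : connect_sym (color_adj c i).
Proof.
apply: sym_connect_sym => x y; rewrite /color_adj.
by under eq_existsb do rewrite setUC.
Qed.

(** This presents the components as the fibres of the map [mono_comp c i], the form that
    [three_partitions] takes. *)
Lemma mem_mono_comp i x y :
  (y \in mono_comp c i x) = (mono_comp c i y == mono_comp c i x).
Proof.
rewrite inE; apply/idP/eqP => [xy|/setP/(_ y)]; last first.
  by rewrite !inE connect0 => <-.
by apply/setP=> z; rewrite !inE (same_connect (@color_adj_sym i) xy).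
Qed.

Lemma mono_comp_id i x : x \in mono_comp c i x.
Proof. by rewrite mem_mono_comp. Qed.

Lemma mono_comp_edge (e : edge n) x y :
  x \in val e -> y \in val e -> mono_comp c (c e) x = mono_comp c (c e) y.
Proof.
have [u [v [_ Ee]]] := edge_ends e.
suff uv : mono_comp c (c e) u = mono_comp c (c e) v.
  by rewrite Ee !inE => /orP[] /eqP-> /orP[] /eqP->.
apply/eqP; rewrite -mem_mono_comp inE (color_adj_sym (c e)) connect1 //.
by apply/existsP; exists e; rewrite Ee !eqxx.
Qed.

Lemma mono_comp_share x y :
  0 < k -> exists i, mono_comp c i x = mono_comp c i y.
Proof.
move=> k_gt0; have [->|xy] := eqVneq x y; first by exists (Ordinal k_gt0).
have e2 : #|[set x; y]| == 2 by rewrite cards2 xy.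
exists (c (Sub [set x; y] e2)).
by apply: mono_comp_edge; rewrite SubK !inE eqxx ?orbT.
Qed.

Definition comp_closed i X := forall x, x \in X -> mono_comp c i x \subset X.

Lemma comp_closed_comp i x : comp_closed i (mono_comp c i x).
Proof. by move=> y; rewrite mem_mono_comp => /eqP->. Qed.

Lemma comp_closedD i X K :
  comp_closed i X -> comp_closed i K -> comp_closed i (X :\: K).
Proof.
move=> cX cK x; rewrite inE => /andP[nKx Xx]; apply/subsetP=> y xy.
rewrite inE (subsetP (cX x Xx)) // andbT; apply: contra nKx => Ky.
apply: (subsetP (cK y Ky)); rewrite mem_mono_comp eq_sym -mem_mono_comp //.
Qed.

(** A closed set is a union of components, so no edge of colour [i] joins [K] to its complement. *)
Lemma card_color_edgesD i X K : comp_closed i K -> K \subset X ->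
  #|color_edges c i X| = #|color_edges c i K| + #|color_edges c i (X :\: K)|.
Proof.
move=> cK KX; rewrite -cardsUI.
have [h1 h2] :
    color_edges c i K :|: color_edges c i (X :\: K) = color_edges c i X /\
    color_edges c i K :&: color_edges c i (X :\: K) = set0.
  split; apply/setP=> e; rewrite !inE; case: eqP => //= ce.
    have [u [v [_ Ee]]] := edge_ends e.
    have uv : mono_comp c i u = mono_comp c i v.
      by rewrite -ce; apply: mono_comp_edge; rewrite Ee !inE eqxx ?orbT.
    have Kuv : (u \in K) = (v \in K).
      by apply/idP/idP => /cK/subsetP; apply; rewrite mem_mono_comp uv.
    rewrite Ee !subUset !sub1set !inE Kuv; case: (boolP (v \in K)) => //= Kv.
    have -> : v \in X by apply: (subsetP KX).
    have -> // : u \in X by apply: (subsetP KX); rewrite Kuv.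
  have [u [v [_ Ee]]] := edge_ends e.
  by rewrite Ee !subUset !sub1set !inE; case: (u \in K); rewrite ?andbF.
by rewrite h1 h2 cards0 addn0.
Qed.

Lemma card_color_edges i X : #|color_edges c i X| <= 'C(#|X|, 2).
Proof.
rewrite -card_edges_within; apply/subset_leq_card/subsetP => e.
by rewrite !inE => /andP[].
Qed.

Lemma sum_color_edges : \sum_i #|color_edges c i setT| = 'C(n, 2).
Proof.
rewrite -card_edge -sum1_card (partition_big c xpredT) //=.
apply: eq_bigr => i _; rewrite sum1dep_card; apply: eq_card => e.
by rewrite !inE subsetT andbT.
Qed.

(* If [a_j] is the number of edges of a component on [n_j] vertices, then
   [a_j <= sqrt (M * 'C(n_j, 2))], and [sqrt 'C(n, 2)] is superadditive in [n]. *)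
Lemma sqr_card_color_edges i M X : comp_closed i X ->
    (forall x, #|mono_comp_edges c i x| <= M) ->
  #|color_edges c i X| ^ 2 <= M * 'C(#|X|, 2).
Proof.
move=> + leM; have [m] := ubnP #|X|; elim: m X => // m IHm X /ltnSE leXm cX.
have [->|[x Xx]] := set_0Vmem X.
  suff -> : #|color_edges c i set0| = 0 by [].
  by have := card_color_edges i set0; rewrite cards0; case: #|_|.
set K := mono_comp c i x; have cK : comp_closed i K by apply: comp_closed_comp.
have KX : K \subset X by apply: cX.
have Kx : x \in K by apply: mono_comp_id.
have XE : #|X| = #|K| + #|X :\: K|.
  by rewrite -(cardsID K X) (setIidPr KX).
have K0 : 0 < #|K| by apply/card_gt0P; exists x.
have {IHm} IH := IHm (X :\: K) _ (comp_closedD cX cK).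
have {IH} := IH _; rewrite (card_color_edgesD cK KX) XE bin2D.
have : #|color_edges c i K| <= M by apply: leM.
have := card_color_edges i K.
have := double_bin2 #|K|; have := double_bin2 #|X :\: K|.
have : #|X :\: K| < m by lia.
move: #|color_edges c i K| #|color_edges c i (X :\: K)| => a b.
move: #|K| #|X :\: K| => p q qm Cq Cp a_le a_leM /(_ qm) b2.
have a2 : a ^ 2 <= M * 'C(p, 2) by rewrite expnS expn1 leq_mul.
(* By [bin2D] the cross term of [(a + b) ^ 2] has to fit into [M * (p * q)]. Its square does,
   because [4 * 'C(p, 2) * 'C(q, 2) <= p ^ 2 * q ^ 2]. *)
have ab : 2 * a * b <= M * (p * q).
  rewrite -leq_sqr; apply: (@leq_trans ((M * 'C(p, 2)) * (M * 'C(q, 2)) * 4)).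
    by rewrite !expnMn -mulnA mulnC leq_mul // leq_mul.
  have : (2 * 'C(p, 2)) * (2 * 'C(q, 2)) <= p ^ 2 * q ^ 2.
    by rewrite Cp Cq; apply: leq_mul; rewrite expnS expn1 leq_mul // leq_pred.
  move=> h; have : M ^ 2 * (2 * 'C(p, 2) * (2 * 'C(q, 2)))
      <= M ^ 2 * (p ^ 2 * q ^ 2) by rewrite leq_mul.
  by rewrite !expnMn; lia.
by rewrite sqrnD; lia.
Qed.

End Components.

(** * Arithmetic of the lower bound *)

Lemma leq_of_sqr_bounds (M N e1 e2 e3 : nat) :
    e1 + e2 + e3 = N -> e1 <= M -> e2 ^ 2 <= M * N -> e3 ^ 2 <= M * N ->
  N <= 6 * M.
Proof.
move=> eN e1M e2M e3M; rewrite leqNgt; apply/negP=> MN.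
have small e : e ^ 2 <= M * N -> 12 * e <= 5 * N.
  by move=> eM; rewrite -leq_sqr !expnMn; nia.
by have := small _ e2M; have := small _ e3M; lia.
Qed.

(** With [t = n - x], the square bound and [1/6 < (5/12)^2] give [b <= (5/12) (x/n) 'C(n, 2)]. As
    [t < n/2], the other two parts contribute at most ['C(t, 2) <= (1/2) (t/n) 'C(n, 2)]. The two
    shares add up to at most half. *)
Lemma large_part_bound (n x y z M b : nat) :
    0 < n -> n < 2 * x -> x + y + z <= n -> 6 * M <= 'C(n, 2) ->
    b ^ 2 <= M * 'C(x, 2) ->
  2 * (b + 'C(y, 2) + 'C(z, 2)) <= 'C(n, 2).
Proof.
move=> n0 n_lt sum_le MN bM.
have Cn := double_bin2 n; have Cx := double_bin2 x.
have Cy := double_bin2 y; have Cz := double_bin2 z.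
have [t nE] : exists t, n = x + t by exists (n - x); lia.
have yz_le : 2 * ('C(y, 2) + 'C(z, 2)) <= t * t.-1.
  by rewrite mulnDr Cy Cz; case: y z sum_le {Cy Cz} => [|y] [|z] /=; nia.
have b_le : 24 * n * b <= 5 * x * (n * n.-1).
  rewrite -leq_sqr !expnMn.
  have h1 : 24 * b ^ 2 <= n * n.-1 * (x * x.-1).
    have : 6 * M * 'C(x, 2) <= 'C(n, 2) * 'C(x, 2) by rewrite leq_mul.
    by rewrite -Cn -Cx; lia.
  have h2 : n * x.-1 <= x * n.-1.
    by case: n x nE {n0 n_lt Cn Cx sum_le MN bM h1} => [|n] [|x] /=; lia.
  have h3 : n ^ 2 * (n * n.-1 * (x * x.-1)) <= x ^ 2 * (n * n.-1) ^ 2.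
    have : n * n.-1 * n * x * (n * x.-1) <= n * n.-1 * n * x * (x * n.-1).
      by rewrite leq_mul2l h2 orbT.
    by rewrite !expnS !expn0 !muln1; lia.
  have : n ^ 2 * (24 * b ^ 2) <= n ^ 2 * (n * n.-1 * (x * x.-1)).
    by rewrite leq_mul2l h1 orbT.
  move=> h4; have := leq_trans h4 h3.
  by rewrite !expnS !expn0 !muln1; lia.
have t_le : 12 * n * (t * t.-1) <= 6 * t * (n * n.-1).
  have : 2 * t.-1 <= n.-1 by lia.
  move=> h; have : 6 * (n * t) * (2 * t.-1) <= 6 * (n * t) * n.-1.
    by rewrite leq_mul2l h orbT.
  by lia.
rewrite -(leq_pmul2l (m := 12 * n)) ?muln_gt0 //.
have : n * (n * n.-1) = x * (n * n.-1) + t * (n * n.-1) by rewrite -mulnDl -nE.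
have : 12 * n * (2 * ('C(y, 2) + 'C(z, 2))) <= 12 * n * (t * t.-1).
  by rewrite leq_mul2l yz_le orbT.
rewrite -Cn in b_le t_le *.
by lia.
Qed.

Lemma leq_of_disjoint_complements (n M b1 b2 b3 x1 x2 x3 : nat) :
    x1 + x2 + x3 <= n ->
    b1 ^ 2 <= M * 'C(x1, 2) -> b2 ^ 2 <= M * 'C(x2, 2) ->
    b3 ^ 2 <= M * 'C(x3, 2) ->
    b1 <= 'C(x1, 2) -> b2 <= 'C(x2, 2) -> b3 <= 'C(x3, 2) ->
    'C(n, 2) <= 3 * M + b1 + b2 + b3 ->
  'C(n, 2) <= 6 * M.
Proof.
move=> sum_le q1 q2 q3 l1 l2 l3 tot; rewrite leqNgt; apply/negP=> MN.
have n0 : 0 < n by case: n MN {sum_le tot}.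
suff : 2 * (b1 + b2 + b3) <= 'C(n, 2) by lia.
(* If some part exceeds [n/2], the square bound is used for that part alone and the trivial binomial
   bounds for the other two. *)
have large x y z b := @large_part_bound n x y z M b n0.
have [n1|n1] := ltnP n (2 * x1).
  by have := large x1 x2 x3 b1 n1 sum_le (ltnW MN) q1; lia.
have [n2|n2] := ltnP n (2 * x2).
  by have := large x2 x1 x3 b2 n2 _ (ltnW MN) q2; lia.
have [n3|n3] := ltnP n (2 * x3).
  by have := large x3 x1 x2 b3 n3 _ (ltnW MN) q3; lia.
have Cn := double_bin2 n.
(* With no part above [n/2], the trivial bounds suffice: ['C(x, 2) <= x (n - 1) / 4], and the parts
   sum to at most [n]. *)
have small x : 2 * x <= n -> 4 * 'C(x, 2) <= x * n.-1.
  move=> xn; have Cx := double_bin2 x.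
  have : x * (2 * x.-1) <= x * n.-1 by apply: leq_mul => //; lia.
  by lia.
have : (x1 + x2 + x3) * n.-1 <= n * n.-1 by rewrite leq_mul2r sum_le orbT.
have := small _ n1; have := small _ n2; have := small _ n3.
rewrite !mulnDl; lia.
Qed.

(** * A component with a sixth of the edges *)

Section ThreeColors.
Variables (n : nat) (c : coloring n 3).

Let i0 : 'I_3 := @Ordinal 3 0 isT.
Let i1 : 'I_3 := @Ordinal 3 1 isT.
Let i2 : 'I_3 := @Ordinal 3 2 isT.

Lemma ord3_cases (i : 'I_3) : [\/ i = i0, i = i1 | i = i2].
Proof.
case: i => -[|[|[|//]]] lti;
  [apply: Or31 | apply: Or32 | apply: Or33]; exact: val_inj.
Qed.

Lemma exists_large_mono_comp : 0 < n ->
  exists i x, 'C(n, 2) <= 6 * #|mono_comp_edges c i x|.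
Proof.
move=> n_gt0; have x0 : 'I_n := Ordinal n_gt0.
have [/existsP[i /existsP[x h]]|none] := boolP [exists i : 'I_3, exists x,
    'C(n, 2) <= 6 * #|mono_comp_edges c i x|]; first by exists i, x.
(* Arguing by contradiction, [M] is the largest integer with [6 * M < 'C(n, 2)], and it bounds every
   component. The predecessor is harmless, since [small] forces ['C(n, 2)] to be positive. *)
pose M := ('C(n, 2)).-1 %/ 6.
have small i x : 6 * #|mono_comp_edges c i x| < 'C(n, 2).
  rewrite ltnNge; apply: contra none => h.
  by apply/existsP; exists i; apply/existsP; exists x.
have leM i x : #|mono_comp_edges c i x| <= M.
  by rewrite leq_divRL // mulnC; have := small i x; lia.
suff : 'C(n, 2) <= 6 * M.
  by have := small i0 x0; have := leq_trunc_div ('C(n, 2)).-1 6; rewrite -/M; lia.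
have tot : #|color_edges c i0 setT| + #|color_edges c i1 setT|
         + #|color_edges c i2 setT| = 'C(n, 2).
  rewrite -(sum_color_edges c) !big_ord_recl big_ord0 addn0 addnA.
  by congr (#|color_edges c _ _| + #|color_edges c _ _| + #|color_edges c _ _|);
    apply: val_inj.
have span i x : (forall v, mono_comp c i v = mono_comp c i x) ->
    #|color_edges c i setT| <= M.
  move=> h; suff -> : setT = mono_comp c i x by apply: leM.
  by apply/setP=> v; rewrite inE mem_mono_comp h eqxx.
have sqrE i : #|color_edges c i setT| ^ 2 <= M * 'C(n, 2).
  rewrite -[in 'C(n, 2)](card_ord n) -cardsT.
  by apply: sqr_card_color_edges (leM i) => x _; apply: subsetT.
have compl i x : #|color_edges c i setT| <=
    M + #|color_edges c i (~: mono_comp c i x)|.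
  rewrite (card_color_edgesD (comp_closed_comp (x := x)) (subsetT _)) setTD.
  by rewrite leq_add2r leM.
have two i : (exists x y, forall v, mono_comp c i v = mono_comp c i x \/
    mono_comp c i v = mono_comp c i y) -> #|color_edges c i setT| <= 2 * M.
  case=> x [y h]; apply: (leq_trans (compl i x)); rewrite mul2n -addnn leq_add2l.
  apply: leq_trans (leM i y); apply/subset_leq_card/subsetP => e.
  rewrite !inE => /andP[-> /= eX]; apply: (subset_trans eX).
  apply/subsetP=> v; rewrite inE !mem_mono_comp => /eqP nv.
  by case: (h v) => // /eqP.
have compC_closed i x : comp_closed c i (~: mono_comp c i x).
  rewrite -setTD; apply: comp_closedD (comp_closed_comp (x := x)) => v _.
  exact: subsetT.
have share u v : [\/ mono_comp c i0 u = mono_comp c i0 v,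
    mono_comp c i1 u = mono_comp c i1 v | mono_comp c i2 u = mono_comp c i2 v].
  have [i] := mono_comp_share c u v isT.
  by case: (ord3_cases i) => ->; [apply: Or31 | apply: Or32 | apply: Or33].
case: (three_partitions x0 share) => [||[h1 h2 h3]].
- case=> -[x h].
  + exact: leq_of_sqr_bounds tot (span _ _ h) (sqrE _) (sqrE _).
  + apply: leq_of_sqr_bounds (span _ _ h) (sqrE i0) (sqrE i2); lia.
  + apply: leq_of_sqr_bounds (span _ _ h) (sqrE i0) (sqrE i1); lia.
- case=> x [y [z h]].
  pose X1 := ~: mono_comp c i0 x; pose X2 := ~: mono_comp c i1 y.
  pose X3 := ~: mono_comp c i2 z.
  apply: (@leq_of_disjoint_complements _ _ #|color_edges c i0 X1|
    #|color_edges c i1 X2| #|color_edges c i2 X3| #|X1| #|X2| #|X3|);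
    rewrite ?card_color_edges //.
  + rewrite -[leqRHS](card_ord n) -cardsUI.
    have -> : X1 :&: X2 = set0.
      apply/setP=> v; rewrite in_setI !in_setC in_set0 !mem_mono_comp.
      by case: (h v) => -[] -> _ _; rewrite eqxx ?andbF.
    rewrite cards0 addn0 -cardsUI.
    have -> : (X1 :|: X2) :&: X3 = set0.
      apply/setP=> v; rewrite in_setI in_setU !in_setC in_set0 !mem_mono_comp.
      by have [_ [] e1 [] e2] := h v; rewrite ?e1 ?e2 !eqxx ?andbF.
    by rewrite cards0 addn0 max_card.
  + exact: sqr_card_color_edges (compC_closed _ _) (leM _).
  + exact: sqr_card_color_edges (compC_closed _ _) (leM _).
  + exact: sqr_card_color_edges (compC_closed _ _) (leM _).
  + by have := compl i0 x; have := compl i1 y; have := compl i2 z;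
      rewrite -/X1 -/X2 -/X3; lia.
- by have := two _ h1; have := two _ h2; have := two _ h3; lia.
Qed.

End ThreeColors.

(** * The four-part colouring *)

(** Greedy: when one element is left, the total capacity exceeds the number already labelled, so
    some label has room. It serves both to split the vertices into parts and to distribute the inner
    edges of a part among the colours. *)
Lemma bounded_labelling (T L : finType) (l0 : L) (S : {set T}) (s : L -> nat) :
  #|S| <= \sum_l s l ->
  exists f : T -> L, forall l, #|[set x in S | f x == l]| <= s l.
Proof.
have [m] := ubnP #|S|; elim: m S => // m IHm S /ltnSE leSm leSs.
have [->|[x Sx]] := set_0Vmem S.
  exists (fun=> l0) => l; rewrite (eq_card0 (A := [set _ in _ | _])) // => y.
  by rewrite !inE.
have S1 : #|S| = #|S :\ x|.+1 by rewrite (cardsD1 x) Sx.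
have [||f fs] := IHm (S :\ x); [lia | lia |].
have [l ltl] : exists l, #|[set y in S :\ x | f y == l]| < s l.
  apply/existsP; apply: contraLR leSs; rewrite negb_exists => /forallP le_s.
  rewrite -ltnNge S1 ltnS -sum1_card (partition_big f xpredT) //= leq_sum // => l _.
  have := le_s l; rewrite -leqNgt sum1dep_card => /leq_trans; apply.
  by apply/subset_leq_card/subsetP => y; rewrite !inE.
exists (fun y => if y == x then l else f y) => k.
have [->|nkl] := eqVneq k l.
  apply: leq_trans ltl; rewrite (cardsD1 x) -[X in _ <= X]add1n leq_add ?leq_b1 //.
  apply/subset_leq_card/subsetP => y; rewrite !inE.
  by case: eqP => //= _; case: (y \in S).
apply: leq_trans (fs k); apply/subset_leq_card/subsetP => y; rewrite !inE.
by case: (eqVneq y x) => [_|_] /=; rewrite ?[l == k]eq_sym ?(negPf nkl) ?andbF.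
Qed.

(* The four parts form the group [bool * bool]; the edges between two parts are
   coloured by one of the three characters that do not separate these parts. *)
Definition side (d : 'I_3) (i : bool * bool) : bool :=
  match val d with 0 => i.1 | 1 => i.2 | _ => i.1 (+) i.2 end.

Lemma side_cross (i j : bool * bool) : exists d, side d i = side d j.
Proof.
have [e1|n1] := eqVneq i.1 j.1; first by exists (@Ordinal 3 0 isT).
have [e2|n2] := eqVneq i.2 j.2; first by exists (@Ordinal 3 1 isT).
by exists (@Ordinal 3 2 isT); case: i j n1 n2 => [[] []] [[] []].
Qed.

Lemma side_partner d i : exists j,
  [/\ i != j, side d i = side d j &
      forall k, side d k = side d i -> k = i \/ k = j].
Proof.
case: d => -[|[|[|//]]] ltd; rewrite /side /=.
- by exists (i.1, ~~ i.2); case: i => [[] []]; split=> // -[[] []] //=; auto.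
- by exists (~~ i.1, i.2); case: i => [[] []]; split=> // -[[] []] //=; auto.
- by exists (~~ i.1, ~~ i.2); case: i => [[] []]; split=> // -[[] []] //=; auto.
Qed.

(** Here [w i] is the capacity of part [i], and [s i d] the number of its inner edges that may
    receive colour [d]. A component of colour [d] stays within two parts that [side d] does not
    separate, so the last hypothesis bounds its edges. *)
Lemma coloring_of_weights (n t : nat) (w : bool * bool -> nat)
    (s : bool * bool -> 'I_3 -> nat) :
    n <= \sum_i w i -> (forall i, 'C(w i, 2) <= \sum_d s i d) ->
    (forall d i j, i != j -> side d i = side d j ->
       w i * w j + s i d + s j d <= t) ->
  exists c : coloring n 3, forall d x, #|mono_comp_edges c d x| <= t.
Proof.
move=> le_n le_s le_t.
have [part Hpart] : exists part : 'I_n -> bool * bool,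
    forall i, #|[set x in setT | part x == i]| <= w i.
  by apply: (bounded_labelling (false, false)); rewrite cardsT card_ord.
pose V i := [set x | part x == i].
have leV i : #|V i| <= w i.
  by apply: leq_trans (Hpart i); apply/subset_leq_card/subsetP => x; rewrite !inE.
have [g leg] : exists g : bool * bool -> edge n -> 'I_3, forall i d,
    #|[set e in [set e : edge n | val e \subset V i] | g i e == d]| <= s i d.
  apply: (@fin_all_exists _ (fun=> edge n -> 'I_3)
    (fun i g => forall d, #|[set e in _ | g e == d]| <= s i d)) => i.
  apply: (bounded_labelling (ord0 : 'I_3)).
  rewrite card_edges_within; apply: leq_trans (le_s i).
  by apply: leq_bin2l.
(* An inner edge takes the colour prescribed by [g]; a crossing edge takes a colour whose character
   agrees on its two parts. *)
pose ok (e : edge n) d := (exists2 i, val e \subset V i & d = g i e) \/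
  exists x y, [/\ val e = [set x; y], part x != part y &
                  side d (part x) = side d (part y)].
have [c0 okc] : exists c0 : edge n -> 'I_3, forall e, ok e (c0 e).
  apply: fin_all_exists => e; have [x [y [_ Ee]]] := edge_ends e.
  have [pxy|pxy] := eqVneq (part x) (part y).
    by exists (g (part x) e); left; exists (part x);
      rewrite // Ee subUset !sub1set !inE pxy eqxx.
  have [d dxy] := side_cross (part x) (part y).
  by exists d; right; exists x, y.
exists [ffun e => c0 e] => d x; set c := finfun _.
pose i := part x; have [j [nij sij ijP]] := side_partner d i.
pose W := [set y | side d (part y) == side d i].
have ok_side e : ok e d -> forall u v, u \in val e -> v \in val e ->
    side d (part u) = side d (part v).
  case=> [[k ek _] u v /(subsetP ek) + /(subsetP ek)|[u0 [v0 [-> _ uv]]] u v].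
    by rewrite !inE => /eqP-> /eqP->.
  by rewrite !inE => /orP[] /eqP-> /orP[] /eqP->.
have compW : mono_comp c d x \subset W.
  apply/subsetP=> y; rewrite inE => xy.
  rewrite -(closed_connect _ xy) ?inE ?eqxx // => u v /existsP[e /andP[/eqP Ee]].
  rewrite ffunE => /eqP ce; rewrite !inE.
  by rewrite (ok_side e _ u v) ?Ee ?inE ?eqxx ?orbT // -ce.
pose I k := [set e in [set e : edge n | val e \subset V k] | g k e == d].
pose X := [set e : edge n |
  [exists u in V i, exists v in V j, val e == [set u; v]]].
have cardX : #|X| <= #|V i| * #|V j|.
  rewrite -cardsX -(card_imset _ val_inj).
  apply: leq_trans (leq_imset_card (fun p => [set p.1; p.2]) _).
  apply/subset_leq_card/subsetP => B /imsetP[e].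
  rewrite inE => /existsP[u /andP[iu /existsP[v /andP[jv /eqP Ee]]]] ->.
  by apply/imsetP; exists (u, v); rewrite // inE iu.
apply: leq_trans (le_t d i j nij sij).
(* The edges of the component are crossing edges between [V i] and [V j], or inner edges of one of
   the two with colour [d]. *)
apply: (@leq_trans #|X :|: I i :|: I j|).
  apply/subset_leq_card/subsetP => e; rewrite inE => /andP[].
  rewrite ffunE => /eqP ce /subset_trans/(_ compW) eW.
  have Wpart u : u \in val e -> part u = i \/ part u = j.
    by move/(subsetP eW); rewrite inE => /eqP/ijP.
  rewrite !in_setU; case: (okc e) => [[k ek ge]|[u [v [Ee nuv _]]]].
    have [u [v [_ Ee]]] := edge_ends e.
    have ue : u \in val e by rewrite Ee !inE eqxx.
    have := subsetP ek u ue; rewrite inE => /eqP uk; rewrite -uk in ek ge.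
    by case: (Wpart u ue) => pu; rewrite pu in ek ge;
      rewrite /I !inE ek -ge ce eqxx ?orbT.
  apply/orP; left; apply/orP; left; rewrite inE.
  have ue : u \in val e by rewrite Ee !inE eqxx.
  have ve : v \in val e by rewrite Ee !inE eqxx orbT.
  case: (Wpart u ue) (Wpart v ve) nuv => pu [] pv; rewrite pu pv ?eqxx // => _.
    by apply/existsP; exists u; rewrite inE pu eqxx; apply/existsP; exists v;
      rewrite inE pv eqxx Ee eqxx.
  by apply/existsP; exists v; rewrite inE pv eqxx; apply/existsP; exists u;
    rewrite inE pu eqxx Ee setUC eqxx.
apply: leq_trans (leq_card_setU _ _) _; rewrite leq_add ?leg //.
apply: leq_trans (leq_card_setU _ _) _; rewrite leq_add ?leg //.
by apply: (leq_trans cardX); rewrite leq_mul.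
Qed.

Lemma exists_balanced_coloring n : 60 <= n ->
  exists c : coloring n 3, forall d x,
    #|mono_comp_edges c d x| <= ('C(n, 2) + 5) %/ 6.
Proof.
move=> n_ge; set t := _ %/ 6.
pose q := n %/ 4; pose r := n %% 4; pose C := 'C(q, 2).
have nE : n = q + r + q + q + q by rewrite {1}(divn_eq n 4) -/q -/r; lia.
have r_lt : r < 4 by rewrite ltn_mod.
have q_ge : 15 <= q by rewrite leq_divRL.
have dbl m : 2 * 'C(m, 2) + m = m * m.
  by rewrite double_bin2; case: m => //= m; rewrite -mulnSr.
have CE := dbl q; rewrite -/C in CE.
have CrE := dbl (q + r); rewrite mulnDl !mulnDr (mulnC r q) in CrE.
have NE : 'C(n, 2) = 'C(q + r, 2) + 3 * C + 3 * (q * (q + r)) + 3 * (q * q).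
  by rewrite nE !bin2D -/C; lia.
have t_ge : 'C(n, 2) <= 6 * t by rewrite /t; lia.
have t_le : 6 * t <= 'C(n, 2) + 5 by rewrite /t; lia.
(* Both values make components reach exactly [t]: two parts of size [q] have [q * q] crossing edges
   and room [D], and the large part meets another in [q * (q + r) + (C - D) + S0 = t]. Its inner
   edges fit into [3 * S0] because ['C(n, 2) <= 6 * t]. *)
pose D := t - q * q.
pose S0 := 2 * t - (2 * (q * q) + q * r + C).
have qq_ge : 15 * q <= q * q by rewrite leq_mul2r q_ge orbT.
have rr_le : r * r <= 3 * 3 by apply: leq_mul.
have qr_le : q * r <= q * 3 by apply: leq_mul.
(* The next three facts keep the natural subtractions in [D], [C - D] and [S0] from truncating. The
   second, which says [D <= C], is why [n] must be large: [q * q] has to outweigh terms of order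
   [12 * q], as [r] may be 3. *)
have t_ge_qq : q * q <= t by lia.
have D_le : t <= q * q + C by lia.
have S0_ge : 2 * (q * q) + q * r + C <= 2 * t by lia.
(* The three parts of size [q] give [D], [C - D] and [0] of their inner edges to
   the three colours, cyclically; every component then gets at most [t] edges. *)
pose w (i : bool * bool) := if i == (false, false) then q + r else q.
pose s (i : bool * bool) (d : 'I_3) :=
  match i, val d with
  | (false, false), _ => S0
  | (false, true), 0 | (true, false), 1 | (true, true), 2 => C - D
  | (false, true), 2 | (true, false), 0 | (true, true), 1 => D
  | _, _ => 0
  end.
apply: (@coloring_of_weights _ _ w s).
- rewrite -(pair_bigA _ (fun a b => w (a, b))) /= !big_bool /= /w /=; lia.
- case=> [[] []]; rewrite !big_ord_recl big_ord0 /w /s /=; lia.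
- case=> -[|[|[|//]]] ltd [[] []] [[] []] //= _ _; rewrite /w /s /= 
    ?mulnDl ?mulnDr ?[r * q]mulnC; lia.
Qed.

(** * Ceilings and the value of [maxMono n 3] *)

Import Order.TTheory GRing.Theory Num.Theory.
Local Open Scope ring_scope.

Lemma ceil_div6 (m : nat) :
  Num.ceil (m%:R / 6%:R : rat) = ((m + 5) %/ 6)%N%:Z.
Proof.
apply: ceil_def; rewrite ltr_pdivlMr // ler_pdivrMr //.
rewrite !pmulrn -!intrM ltr_int ler_int.
by apply/andP; split; lia.
Qed.

Theorem theorem2 :
  (forall n : nat, (0 < n)%N ->
     (forall c : coloring n 3, exists (i : 'I_3) (x : 'I_n),
        ('C(n, 2))%:R / 6%:R <= (#|mono_comp_edges c i x|)%:R :> rat) /\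
     Num.ceil (('C(n, 2))%:R / 6%:R : rat) <= (maxMono n 3)%:Z) /\
  (exists n0 : nat, forall n : nat, (n0 <= n)%N ->
     (maxMono n 3)%:Z = Num.ceil (('C(n, 2))%:R / 6%:R : rat)).
Proof.
have lower n : (0 < n)%N -> (('C(n, 2) + 5) %/ 6 <= maxMono n 3)%N.
  move=> n_gt0; apply: (maxMonoP n_gt0 (isT : (0 < 3)%N)).2.
  apply/forallP=> c; have [i [x le_x]] := exists_large_mono_comp c n_gt0.
  by apply/existsP; exists i; apply/existsP; exists x; lia.
split=> [n n_gt0|].
  split=> [c|]; last by rewrite ceil_div6 lez_nat lower.
  have [i [x le_x]] := exists_large_mono_comp c n_gt0.
  by exists i, x; rewrite ler_pdivrMr // -natrM ler_nat mulnC.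
exists 60%N => n n_ge; rewrite ceil_div6; congr Posz.
have n_gt0 : (0 < n)%N by apply: leq_trans n_ge.
apply/eqP; rewrite eqn_leq lower // andbT.
have [c le_c] := exists_balanced_coloring n_ge.
have /forallP/(_ c)/existsP[i /existsP[x le_x]] :=
  (maxMonoP n_gt0 (isT : (0 < 3)%N)).1.
exact: leq_trans le_x (le_c i x).
Qed.
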